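(* Suppose that $h:\mathbb C\to\mathbb R$ is continuous. (a) If $h$ is constant, then $\frac12+\mathcal R_h(\mathbf z)>0$ for any three-tuple $\mathbf z$ of non-collinear points in $\mathbb C$. (b) If $h$ is not constant, then the function $\mathbf z\mapsto\frac12+\mathcal R_h(\mathbf z)$ changes sign; that is, there exist two three-tuples of non-collinear points $\mathbf z$ and $\mathbf z'$ in $\mathbb C$ such that $$\tfrac12+\mathcal R_h(\mathbf z)>0\quad\text{and}\quad\tfrac12+\mathcal R_h(\mathbf z')<0.$$ Furthermore, (a) and (b) are also true with $\frac12-\mathcal R_h$ in place of $\frac12+\mathcal R_h$.
   Context: For $h:\mathbb C\to\mathbb R$, let $K_h(w,z)=\frac{e^{ih(w)}}{w-z}$ for $w\neq z$ in $\mathbb C$. For a kernel $K(w,z)$ defined for $w\ne z$ and a three-tuple $\mathbf z=\{z_1,z_2,z_3\}$ of distinct points in $\mathbb C$, the symmetrized form is $$\mathtt S[K](\mathbf z):=\sum_{\sigma\in S_3}K(z_{\sigma(1)},z_{\sigma(2)})\,\overline{K(z_{\sigma(1)},z_{\sigma(3)})},$$ where $S_3$ is the group of permutations of $\{1,2,3\}$. The Menger curvature $c(\mathbf z)$ of three non-collinear points is the reciprocal of the radius of the unique circle passing through them; $c^2(\mathbf z)=(c(\mathbf z))^2$. The function $\mathcal R_h$ is defined on three-tuples $\mathbf z$ of non-collinear points by the identity $$\mathtt S[\mathrm{Re}\,K_h](\mathbf z)=c^2(\mathbf z)\left(\tfrac12+\mathcal R_h(\mathbf z)\right),$$ where $\mathrm{Re}\,K_h$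 is the real part of the kernel $K_h$. *)

(* Defs.v *)
From HB Require Import structures.
From mathcomp Require Import all_boot all_order all_algebra all_fingroup.
From mathcomp Require Import complex.
From mathcomp Require Import all_classical all_reals all_analysis.
From mathcomp Require Import ring lra.

Set Implicit Arguments.
Unset Strict Implicit.
Unset Printing Implicit Defensive.

Import Order.TTheory GRing.Theory Num.Theory.
Import numFieldNormedType.Exports.

Local Open Scope classical_set_scope.
Local Open Scope ring_scope.
Local Open Scope complex_scope.

Section SymmetrizedKernels.
Context {R : realType}.
Local Notation C := R[i].
Implicit Types (z : 'I_3 -> C) (K : C -> C -> C) (h : C -> R).

Definition collinear z :=
  exists a d : C, d != 0 /\ forall i, exists t : R, z i = a + t%:C * d.

Definition circumradius z (r : R) :=
  0 < r /\ exists a : C, forall i, `|z i - a| = r%:C.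

(* [get] picks the radius, which exists and is unique when [z] is not
   collinear: see [circumradius_ex] and [circumradius_uniq] below. *)
Definition menger_curvature z : R := (get [set r | circumradius z r])^-1.

(* e^(it) for real t, by Euler's formula *)
Definition expi (t : R) : C := cos t +i* sin t.

(* K_h; the junk value on the diagonal, x / 0 = 0, is never used below, since
   the points of a non-collinear triple are distinct. *)
Definition kernel h (w z : C) : C := expi (h w) / (w - z).

Definition re_kernel K (w z : C) : C := (complex.Re (K w z))%:C.

Definition symmetrization K z : C :=
  \sum_(s : 'S_3)
    K (z (s 0)) (z (s 1)) * (K (z (s 0)) (z (s 2%:R)))^*.

(* Solves  S[Re K_h](z) = c^2(z) (1/2 + R_h(z))  for R_h(z); the left-hand side
   is real: see [remainderE] and [remainder_uniq] below. *)
Definition remainder h z : R :=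
  complex.Re (symmetrization (re_kernel (kernel h)) z) / menger_curvature z ^+ 2
  - 2^-1.

Let normE (x : C) (r : R) : 0 < r ->
  (`|x| = r%:C) <-> complex.Re x ^+ 2 + complex.Im x ^+ 2 = r ^+ 2.
Proof.
move=> r0; rewrite normc_def; split=> [[<-]|->].
  by rewrite sqr_sqrtr // addr_ge0 ?sqr_ge0.
by rewrite sqrtr_sqr gtr0_norm.
Qed.

Let area z : R :=
  (complex.Re (z 1) - complex.Re (z 0)) * (complex.Im (z 2%:R) - complex.Im (z 0))
  - (complex.Im (z 1) - complex.Im (z 0)) * (complex.Re (z 2%:R) - complex.Re (z 0)).

Let all3 (P : 'I_3 -> Prop) : P 0 -> P 1 -> P 2%:R -> forall i, P i.
Proof.
move=> P0 P1 P2; case=> -[|[|[|//]]] lti.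
- by rewrite (_ : Ordinal lti = 0) //; exact: val_inj.
- by rewrite (_ : Ordinal lti = 1) //; exact: val_inj.
- by rewrite (_ : Ordinal lti = 2%:R) //; exact: val_inj.
Qed.

Let area_neq0 z : ~ collinear z -> area z != 0.
Proof.
move=> zN; apply/eqP => A0; apply: zN.
have [z10|z10] := eqVneq (z 1) (z 0).
  have [z20|z20] := eqVneq (z 2%:R) (z 0).
    exists (z 0), 1; split; first exact: oner_neq0.
    by apply: all3; exists 0; rewrite ?z10 ?z20 mul0r addr0.
  exists (z 0), (z 2%:R - z 0); split; first by rewrite subr_eq0.
  apply: all3; [exists 0|exists 0|exists 1]; rewrite ?z10 ?mul0r ?addr0 //.
  by rewrite mul1r addrC subrK.
exists (z 0), (z 1 - z 0); split; first by rewrite subr_eq0.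
apply: all3; [exists 0|exists 1|].
- by rewrite mul0r addr0.
- by rewrite mul1r addrC subrK.
move: A0 z10; rewrite /area.
case: (z 0) (z 1) (z 2%:R) => a b [c d] [e f] /= A0.
rewrite eq_complex /= negb_and.
case: (eqVneq c a) A0 => [->|ca] A0 /= => [db|_].
  have {}db : d - b != 0 by rewrite subr_eq0.
  exists ((f - b) / (d - b)); apply/eqP; rewrite eq_complex /=.
  have ea : e = a by apply: (mulfI db); lra.
  by rewrite ea; apply/andP; split; apply/eqP; field.
have {}ca : c - a != 0 by rewrite subr_eq0.
exists ((e - a) / (c - a)); apply/eqP; rewrite eq_complex /=.
have fb : f - b = (d - b) * (e - a) / (c - a).
  by apply: (mulIf ca); rewrite divfK //; lra.
have -> : f = b + (f - b) by ring.
by rewrite fb; apply/andP; split; apply/eqP; field.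
Qed.

Lemma circumradius_ex z : ~ collinear z -> exists r, circumradius z r.
Proof.
move=> /area_neq0; rewrite /area.
case E0 : (z 0) => [a b]; case E1 : (z 1) => [c d]; case E2 : (z 2%:R) => [e f].
rewrite /= => A0.
pose D := (c - a) * (f - b) - (d - b) * (e - a).
pose p := (c - a) ^+ 2 + (d - b) ^+ 2.
pose q := (e - a) ^+ 2 + (f - b) ^+ 2.
pose u := ((f - b) * p - (d - b) * q) / (2 * D).
pose v := ((c - a) * q - (e - a) * p) / (2 * D).
have D0 : D != 0 by [].
have Hu1 : 2 * (u * (c - a) + v * (d - b)) = p by rewrite /u /v /p /q /D; field.
have Hu2 : 2 * (u * (e - a) + v * (f - b)) = q by rewrite /u /v /p /q /D; field.
have uv0 : 0 < u ^+ 2 + v ^+ 2.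
  rewrite lt_def addr_ge0 ?sqr_ge0 // andbT paddr_eq0 ?sqr_ge0 //.
  rewrite !sqrf_eq0; apply: contra D0 => /andP[/eqP u0 /eqP v0].
  move: Hu1; rewrite u0 v0 !mul0r addr0 mulr0 => /esym/eqP.
  rewrite paddr_eq0 ?sqr_ge0 // !sqrf_eq0 => /andP[/eqP ca /eqP db].
  by rewrite /D ca db !mul0r subr0.
exists (Num.sqrt (u ^+ 2 + v ^+ 2)); split; first by rewrite sqrtr_gt0.
exists ((a + u) +i* (b + v)).
apply: all3; rewrite ?E0 ?E1 ?E2; apply/normE; rewrite ?sqrtr_gt0 //=
  sqr_sqrtr ?(ltW uv0) //; move: Hu1 Hu2; rewrite /p /q; nra.
Qed.

Lemma circumradius_uniq z r r' :
  ~ collinear z -> circumradius z r -> circumradius z r' -> r = r'.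
Proof.
move=> /area_neq0; rewrite /area => A0 [r0 [x Hx]] [r'0 [y Hy]].
move: (Hx 0) (Hx 1) (Hx 2%:R) (Hy 0) (Hy 1) (Hy 2%:R) => {Hx Hy}.
move=> /(normE _ r0) + /(normE _ r0) + /(normE _ r0) +
  /(normE _ r'0) + /(normE _ r'0) + /(normE _ r'0).
move: A0; case: (z 0) (z 1) (z 2%:R) x y => a b [c d] [e f] [x1 x2] [y1 y2] /=.
set D := _ - _ => D0 h1 h2 h3 h4 h5 h6.
have E1 : (c - a) * (x1 - y1) + (d - b) * (x2 - y2) = 0 by lra.
have E2 : (e - a) * (x1 - y1) + (f - b) * (x2 - y2) = 0 by lra.
have e1 : D * (x1 - y1) = 0.
  transitivity ((f - b) * 0 - (d - b) * 0 : R); last by ring.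
  by rewrite -{1}E1 -E2 /D; ring.
have e2 : D * (x2 - y2) = 0.
  transitivity ((c - a) * 0 - (e - a) * 0 : R); last by ring.
  by rewrite -{1}E2 -E1 /D; ring.
move/eqP: e1; move/eqP: e2; rewrite !mulf_eq0 (negPf D0) /= !subr_eq0.
move=> /eqP ? /eqP ?; subst y1 y2.
by apply/eqP; rewrite -(eqrXn2 (ltn0Sn 1)) ?ltW // -h1 -h4.
Qed.

Lemma menger_curvatureE z r :
  ~ collinear z -> circumradius z r -> menger_curvature z = r^-1.
Proof.
move=> zN zr; congr (_^-1); apply: (circumradius_uniq zN _ zr).
exact: (@getI _ [set r | circumradius z r] _ zr).
Qed.

Lemma menger_curvature_gt0 z : ~ collinear z -> 0 < menger_curvature z.
Proof.
move=> zN; have [r zr] := circumradius_ex zN.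
by rewrite (menger_curvatureE zN zr) invr_gt0; case: zr.
Qed.

Lemma remainderE h z : ~ collinear z ->
  symmetrization (re_kernel (kernel h)) z
  = (menger_curvature z ^+ 2 * (2^-1 + remainder h z))%:C.
Proof.
move=> /menger_curvature_gt0 c0.
rewrite /remainder addrC subrK mulrC divfK ?expf_neq0 ?gt_eqF //.
apply/esym/RRe_real/rpred_sum => s _.
apply: rpredM; apply/complex_realP; first by exists (complex.Re (kernel h (z (s 0)) (z (s 1)))).
exists (complex.Re (kernel h (z (s 0)) (z (s 2%:R)))); exact: conjc_real.
Qed.

Lemma remainder_uniq h (rho : ('I_3 -> C) -> R) z : ~ collinear z ->
  symmetrization (re_kernel (kernel h)) z
  = (menger_curvature z ^+ 2 * (2^-1 + rho z))%:C ->
  rho z = remainder h z.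
Proof.
move=> zN; rewrite remainderE // => -[] /mulfI.
by move=> /(_ (expf_neq0 _ (lt0r_neq0 (menger_curvature_gt0 zN)))) /addrI.
Qed.

End SymmetrizedKernels.

(* Main.v *)
Require Import Defs.
From mathcomp Require Import all_boot all_order all_algebra.
From mathcomp Require Import perm complex.
From mathcomp Require Import all_classical all_reals all_analysis.
From mathcomp Require Import ring lra.

(** Write u_j for the unit vector e^(i h(z_j)) and D for twice the signed area
    of the triangle z. Clearing denominators and using c = 2 |D| / (product of
    the side lengths), one finds ([half_add_remainder])

      1/2 + R_h(z) = N(z) / (2 D^2),

    where N(z) ([numerator]) sums, over the vertices z_j, the product of
    <u_j, z_j - z_k>, <u_j, z_j - z_l> and |z_k - z_l|^2.

    If h is constant then N = D^2, a polynomial identity, so R_h vanishes and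
    (a) holds for both signs.

    If h is not constant, R_h is in fact unbounded above and below
    ([remainder_unbounded]), because N has no reason to vanish with D. On
    a collinear triple z_j = x + t_j d, the number N(z) is a positive multiple
    of the second divided difference at t_1, t_2, t_3 of the function
    p(t) = <e^(i h(x + t d)), d>^2 ([numerator_line]). This p is bounded, with
    values in [0, |d|^2], and a bounded function on the line with second
    divided differences of constant sign is convex or concave, hence constant.
    So if p is not constant, N takes both signs on collinear triples
    ([divdiff_num_gt0], [divdiff_num_lt0]). Moving the third point slightly off
    the line changes N little, h being continuous, while D is nonzero but
    arbitrarily small: N / (2 D^2) is then as large as desired, with the sign
    of N ([remainder_unbounded_near]).

    It remains to find a line on which p is not constant. Take the line through
    two points where h differs: by the intermediate value theorem h takes there
    all values of an interval, and v |-> <e^(iv), d>^2 is not constant on any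
    interval ([dot_expi_nonconst], [nonconst_line]). *)

Import Order.TTheory GRing.Theory Num.Theory.
Import numFieldNormedType.Exports.

Local Open Scope ring_scope.

(** * Planar geometry in coordinates *)

Section Planar.
Local Open Scope classical_set_scope.
Local Open Scope ring_scope.
Context {R : realType}.
Local Notation C := R[i].
Implicit Types (x y w : C) (z : 'I_3 -> C) (h : C -> R).

Definition dot x y : R :=
  complex.Re x * complex.Re y + complex.Im x * complex.Im y.

Definition cross x y : R :=
  complex.Re x * complex.Im y - complex.Im x * complex.Re y.

Lemma dot_ge0 x : 0 <= dot x x.
Proof. by rewrite addr_ge0 // -expr2 sqr_ge0. Qed.

Lemma dot_eq0 x : (dot x x == 0) = (x == 0).
Proof.
case: x => a b; rewrite /dot /= -!expr2 paddr_eq0 ?sqr_ge0 // !sqrf_eq0.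
by rewrite eq_complex.
Qed.

Lemma dot_gt0 x : x != 0 -> 0 < dot x x.
Proof. by move=> x0; rewrite lt_def dot_eq0 x0 dot_ge0. Qed.

Lemma dot_expi (t : R) : dot (expi t) (expi t) = 1.
Proof. by rewrite /dot /= -!expr2 cos2Dsin2. Qed.

Lemma norm_dot x (r : R) : `|x| = r%:C%C -> dot x x = r ^+ 2.
Proof.
rewrite normc_def => -[<-].
by rewrite sqr_sqrtr ?addr_ge0 ?sqr_ge0 // /dot -!expr2.
Qed.

Lemma ord3P (P : 'I_3 -> Prop) : P 0 -> P 1 -> P 2%:R -> forall i, P i.
Proof.
move=> P0 P1 P2 [[|[|[|//]]] lti].
- by rewrite (_ : Ordinal lti = 0) //; exact: val_inj.
- by rewrite (_ : Ordinal lti = 1) //; exact: val_inj.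
- by rewrite (_ : Ordinal lti = 2%:R) //; exact: val_inj.
Qed.

Lemma collinear_cross z :
  collinear z <-> cross (z 1 - z 0) (z 2%:R - z 0) = 0.
Proof.
split=> [[a [d [_ zE]]]|].
  have [[[s ->] [t ->]] [u ->]] := (zE 0, zE 1, zE 2%:R).
  by case: a d {zE} => a1 a2 [d1 d2]; rewrite /cross /=; ring.
have [z10|z10] := eqVneq (z 1) (z 0) => [_|A0].
  have [z20|z20] := eqVneq (z 2%:R) (z 0).
    exists (z 0), 1; split; first exact: oner_neq0.
    by apply: ord3P; exists 0; rewrite ?z10 ?z20 mul0r addr0.
  exists (z 0), (z 2%:R - z 0); split; first by rewrite subr_eq0.
  apply: ord3P; [exists 0|exists 0|exists 1]; rewrite ?z10 ?mul0r ?addr0 //.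
  by rewrite mul1r addrC subrK.
have d0 : z 1 - z 0 != 0 by rewrite subr_eq0.
exists (z 0), (z 1 - z 0); split => //.
apply: ord3P; [exists 0|exists 1|].
- by rewrite mul0r addr0.
- by rewrite mul1r addrC subrK.
pose q := (z 2%:R - z 0) / (z 1 - z 0).
exists (complex.Re q).
(* the imaginary part of q is a multiple of the cross product *)
have -> : (complex.Re q)%:C%C = q.
  apply/eqP; rewrite eq_complex /= eqxx /=; apply/eqP/esym; rewrite /q.
  move: A0; case: (z 1 - z 0) (z 2%:R - z 0) => a b [c e].
  rewrite /cross /= => A0.
  rewrite mulrN addrC mulrA mulrA -mulrBl.
  by rewrite (_ : _ - _ = 0) ?mul0r //; lra.
by rewrite /q divfK // addrC subrK.
Qed.

(** The circumcentre relative to z_0 is the vector - w below; equality of the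
    three distances says that - 2 <a, w> = |a|^2 and - 2 <b, w> = |b|^2. These
    two products determine w in the basis (a, b), so |w|^2 D^2 is a quadratic
    form in them with the Gram coefficients of (a, b). *)
Lemma menger_curvature_sqr z (a := z 1 - z 0) (b := z 2%:R - z 0) :
  ~ collinear z ->
  menger_curvature z ^+ 2
  = 4 * cross a b ^+ 2 / (dot a a * dot b b * dot (a - b) (a - b)).
Proof.
move=> zN; have [r zr] := circumradius_ex zN.
rewrite (menger_curvatureE zN zr).
have [r0 [m Hm]] := zr.
have cr0 : cross a b != 0 by apply/eqP => /collinear_cross.
have := (norm_dot _ _ (Hm 0), norm_dot _ _ (Hm 1), norm_dot _ _ (Hm 2%:R)).
have -> : z 1 - m = a + (z 0 - m) by rewrite /a addrA subrK.
have -> : z 2%:R - m = b + (z 0 - m) by rewrite /b addrA subrK.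
move: (z 0 - m) a b cr0 => w a b cr0 [[h0 h1] h2].
have e1 : - 2 * dot a w = dot a a.
  by move: h1; rewrite -h0 /dot; case: (a) (w) => [? ?] [? ?] /=; lra.
have e2 : - 2 * dot b w = dot b b.
  by move: h2; rewrite -h0 /dot; case: (b) (w) => [? ?] [? ?] /=; lra.
have E : 4 * cross a b ^+ 2 * r ^+ 2 = dot a a * dot b b * dot (a - b) (a - b).
  rewrite -h0.
  have -> : dot (a - b) (a - b) = dot a a + dot b b - 2 * dot a b.
    by case: (a) (b) => [? ?] [? ?]; rewrite /dot /=; ring.
  (* |w|^2 D^2 through the products of w with a and b (Gram determinant) *)
  transitivity (4 * (dot a a * dot b w ^+ 2 + dot b b * dot a w ^+ 2
                     - 2 * dot a b * dot a w * dot b w)).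
    by case: (a) (b) (w) => [? ?] [? ?] [? ?]; rewrite /dot /cross /=; ring.
  transitivity (dot a a * (- 2 * dot b w) ^+ 2 + dot b b * (- 2 * dot a w) ^+ 2
                     - 2 * dot a b * (- 2 * dot a w) * (- 2 * dot b w)).
    by ring.
  by rewrite e1 e2; ring.
have r0' := lt0r_neq0 r0.
by rewrite -E; field; rewrite r0' cr0.
Qed.

(** * The symmetrized kernel as a rational function *)

Lemma re_kernel_dot h x y :
  complex.Re (Defs.kernel h x y)
  = dot (expi (h x)) (x - y) / dot (x - y) (x - y).
Proof.
rewrite /Defs.kernel; case: (x - y) => a b; rewrite /dot /= -!expr2.
ring.
Qed.

Lemma sum_S3 (V : nmodType) (F : 'I_3 -> 'I_3 -> 'I_3 -> V) :
  \sum_(s : 'S_3) F (s 0) (s 1) (s 2%:R)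
  = F 0 1 2%:R + F 0 2%:R 1 + (F 1 0 2%:R + F 1 2%:R 0)
    + (F 2%:R 0 1 + F 2%:R 1 0).
Proof.
pose t01 : 'S_3 := tperm 0 1; pose t02 : 'S_3 := tperm 0 2%:R.
pose t12 : 'S_3 := tperm 1 2%:R.
pose l : seq 'S_3 := [:: 1%g; t12; t01; (t01 * t02)%g; (t02 * t01)%g; t02].
have lu : uniq l.
  apply: (@map_uniq _ _ (fun s : 'S_3 => (val (s 0), val (s 1)))).
  by rewrite /l /= !permM !permE.
have lP : perm_eq (index_enum ('S_3 : finType)) l.
  have sub : {subset l <= index_enum ('S_3 : finType)}.
    by move=> s _; exact: mem_index_enum.
  have sz : (size (index_enum ('S_3 : finType)) <= size l)%N.
    rewrite -[size (index_enum _)]/(size (Finite.enum _)).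
    by rewrite -enumT -cardE card_Sn.
  have [_ lE] := uniq_min_size lu sub sz.
  by rewrite perm_sym; apply: uniq_perm => //; exact: index_enum_uniq.
rewrite (perm_big _ lP) /l !big_cons big_nil /=.
have E (s : 'S_3) (i j k : 'I_3) : s 0 = i -> s 1 = j -> s 2%:R = k ->
    F (s 0) (s 1) (s 2%:R) = F i j k by move=> -> -> ->.
have e0 := E 1%g 0 1 2%:R (perm1 _) (perm1 _) (perm1 _).
have e1 : F (t12 0) (t12 1) (t12 2%:R) = F 0 2%:R 1 by apply: E; rewrite permE.
have e2 : F (t01 0) (t01 1) (t01 2%:R) = F 1 0 2%:R by apply: E; rewrite permE.
have e3 : F ((t01 * t02)%g 0) ((t01 * t02)%g 1) ((t01 * t02)%g 2%:R)
          = F 1 2%:R 0 by apply: E; rewrite permM !permE.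
have e4 : F ((t02 * t01)%g 0) ((t02 * t01)%g 1) ((t02 * t01)%g 2%:R)
          = F 2%:R 0 1 by apply: E; rewrite permM !permE.
have e5 : F (t02 0) (t02 1) (t02 2%:R) = F 2%:R 1 0 by apply: E; rewrite permE.
rewrite e0 e1 e2 e3 e4 e5.
by rewrite addr0 !addrA.
Qed.

Definition numerator h x y w : R :=
  dot (expi (h x)) (x - y) * dot (expi (h x)) (x - w) * dot (y - w) (y - w)
  + dot (expi (h y)) (y - x) * dot (expi (h y)) (y - w) * dot (x - w) (x - w)
  + dot (expi (h w)) (w - x) * dot (expi (h w)) (w - y) * dot (x - y) (x - y).

(** Exchanging the last two points does not change a term of the sum over 'S_3,
    so each vertex z_j contributes two equal terms. The common denominator is
    the product of the squared side lengths, which also occurs in the squared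
    curvature and cancels. *)
Lemma half_add_remainder h z : ~ collinear z ->
  2^-1 + remainder h z = numerator h (z 0) (z 1) (z 2%:R)
    / (2 * cross (z 1 - z 0) (z 2%:R - z 0) ^+ 2).
Proof.
move=> zN; rewrite /remainder addrC subrK menger_curvature_sqr //.
have cr0 : cross (z 1 - z 0) (z 2%:R - z 0) != 0.
  by apply/eqP => /collinear_cross.
set k := fun i j : 'I_3 => complex.Re (Defs.kernel h (z i) (z j)).
have -> : complex.Re (symmetrization (re_kernel (Defs.kernel h)) z)
   = \sum_(s : 'S_3) k (s 0) (s 1) * k (s 0) (s 2%:R).
  rewrite /symmetrization (raddf_sum (@complex.Re R)); apply: eq_bigr => s _.
  transitivity (complex.Re ((k (s 0) (s 1))%:C%C * (k (s 0) (s 2%:R))%:C%C)).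
    by congr (complex.Re (_ * _)); exact: conjc_real.
  by rewrite -rmorphM.
rewrite (sum_S3 _ (fun a b c => k a b * k a c)) /k !re_kernel_dot /numerator.
have dotN x y : dot (x - y) (x - y) = dot (y - x) (y - x).
  by case: x y => [? ?] [? ?]; rewrite /dot /=; ring.
have -> : z 1 - z 0 - (z 2%:R - z 0) = z 1 - z 2%:R.
  by rewrite opprB addrA subrK.
rewrite (dotN (z 0) (z 1)) (dotN (z 0) (z 2%:R)) (dotN (z 2%:R) (z 1)).
have d10 : dot (z 1 - z 0) (z 1 - z 0) != 0.
  rewrite dot_eq0; apply: contra cr0 => /eqP ->.
  by rewrite /cross /= !mul0r subrr.
have d20 : dot (z 2%:R - z 0) (z 2%:R - z 0) != 0.
  rewrite dot_eq0; apply: contra cr0 => /eqP ->.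
  by rewrite /cross /= !mulr0 subrr.
have d12 : dot (z 1 - z 2%:R) (z 1 - z 2%:R) != 0.
  rewrite dot_eq0; apply: contra cr0 => /eqP/subr0_eq ->.
  by rewrite /cross mulrC subrr.
by field; rewrite d10 d20 d12 cr0.
Qed.

(** Multiplying the right-hand side by |e^(ic)|^2 = 1 turns this into an identity
    between polynomials in the coordinates of x, y, w and e^(ic). *)
Lemma numerator_const h x y w (c : R) : (forall v, h v = c) ->
  numerator h x y w = cross (y - x) (w - x) ^+ 2.
Proof.
move=> hc; rewrite /numerator !hc -[RHS]mul1r -(dot_expi c).
case: x y w (expi c) => [? ?] [? ?] [? ?] [? ?].
by rewrite /dot /cross /=; ring.
Qed.

Lemma remainder_const h z (c : R) : (forall v, h v = c) -> ~ collinear z ->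
  remainder h z = 0.
Proof.
move=> hc zN; apply: (addrI 2^-1); rewrite half_add_remainder //.
rewrite (numerator_const _ _ _ _ _ hc) addr0.
have cr0 : cross (z 1 - z 0) (z 2%:R - z 0) != 0.
  by apply/eqP => /collinear_cross.
by field.
Qed.

(** * Second divided differences *)

(** The second divided difference p[r, s, t], multiplied by the squared
    Vandermonde product (r - s)^2 (r - t)^2 (s - t)^2 to have no denominator;
    the sign is unchanged when r, s, t are distinct. *)
Definition divdiff_num (p : R -> R) (r s t : R) : R :=
  p r * (r - s) * (r - t) * (s - t) ^+ 2
  + p s * (s - r) * (s - t) * (r - t) ^+ 2
  + p t * (t - r) * (t - s) * (r - s) ^+ 2.

(** Differences of points of the line are real multiples of d, so every factor of
    the numerator splits into a product of parameter differences and a factor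
    that only involves d and one value of h. *)
Lemma numerator_line h x d (r s t : R) :
  numerator h (x + r%:C%C * d) (x + s%:C%C * d) (x + t%:C%C * d)
  = dot d d
    * divdiff_num (fun u => dot (expi (h (x + u%:C%C * d))) d ^+ 2) r s t.
Proof.
rewrite /numerator /divdiff_num.
move: (expi _) (expi _) (expi _) => u v w.
by case: x d u v w => [? ?] [? ?] [? ?] [? ?] [? ?]; rewrite /dot /=; ring.
Qed.

(** The chord of p through r and s has nonzero slope, so it takes the value A,
    a strict lower bound of p, at some t; there p lies above the chord, and t is
    outside the segment [r, s] because p r and p s are both greater than A.
    This makes the divided difference positive. *)
Lemma divdiff_num_gt0 (p : R -> R) (A r s : R) :
  (forall u, A < p u) -> p r != p s -> exists t, 0 < divdiff_num p r s t.
Proof.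
move=> pA prs.
have q0 : p s - p r != 0 by rewrite subr_eq0 eq_sym.
have rs : r - s != 0 by rewrite subr_eq0; apply: contra prs => /eqP ->.
pose m := (s - r) / (p s - p r).
have m0 : m != 0 by rewrite mulf_neq0 ?invr_eq0 // -opprB oppr_eq0.
exists (r + m * (A - p r)).
set t := r + _.
have -> : divdiff_num p r s t
   = (p t - A) * (m ^+ 2 * ((p r - A) * (p s - A))) * (r - s) ^+ 2.
  have sE : s = r + m * (p s - p r) by rewrite /m divfK // addrC subrK.
  have tE : t = r + m * (A - p r) by [].
  rewrite /divdiff_num; clearbody t m.
  by move: (p t) (p s) (p r) sE tE => pt ps pr -> ->; ring.
have [[pt pr] ps] := (pA t, pA r, pA s).
have m2 : 0 < m ^+ 2 by rewrite exprn_even_gt0.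
have rs2 : 0 < (r - s) ^+ 2 by rewrite exprn_even_gt0.
apply: (mulr_gt0 _ rs2); apply: mulr_gt0; first by rewrite subr_gt0.
by apply: (mulr_gt0 m2); apply: mulr_gt0; rewrite subr_gt0.
Qed.

Lemma divdiff_num_lt0 (p : R -> R) (B r s : R) :
  (forall u, p u < B) -> p r != p s -> exists t, divdiff_num p r s t < 0.
Proof.
move=> pB prs.
have [| |t] := @divdiff_num_gt0 (fun u => - p u) (- B) r s.
- by move=> u; rewrite ltrN2.
- by rewrite eqr_opp.
- move=> W; exists t; rewrite -oppr_gt0; apply: lt_le_trans W _.
  by rewrite le_eqVlt; apply/orP; left; apply/eqP; rewrite /divdiff_num; ring.
Qed.

(** * A line along which the projections of e^(ih) vary *)

Lemma dot_expi_bounds (v : R) d : 0 <= dot (expi v) d ^+ 2 <= dot d d.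
Proof.
rewrite sqr_ge0 /= -subr_ge0.
have -> : dot d d - dot (expi v) d ^+ 2 = cross (expi v) d ^+ 2.
  rewrite -[dot d d]mul1r -(dot_expi v).
  by case: d (expi v) => [? ?] [? ?]; rewrite /dot /cross /=; ring.
exact: sqr_ge0.
Qed.

(** With f = <e^(iv), d> and g the derivative of v |-> <e^(iv), d>, the
    addition formulas give the values f cos e + g sin e and f cos e - g sin e at
    v + e and v - e. Both squares are f^2: their
    difference gives f g = 0 and
    their sum f^2 = g^2, so that |d|^2 = f^2 + g^2 = 0. *)
Lemma dot_expi_nonconst (v e : R) d : 0 < e < 1 ->
  dot (expi (v + e)) d ^+ 2 = dot (expi v) d ^+ 2 ->
  dot (expi (v - e)) d ^+ 2 = dot (expi v) d ^+ 2 -> d = 0.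
Proof.
move=> /andP[e0 e1].
(* e < 1 <= pi / 2 makes both cos e and sin e positive *)
have pi1 := pihalf_ge1 R.
have ce : 0 < cos e by apply: cos_gt0_pihalf; apply/andP; split; lra.
have se : 0 < sin e by apply: sin_gt0_pi; apply/andP; split; lra.
pose f := dot (expi v) d; pose g := cross (expi v) d.
have -> : dot (expi (v + e)) d = f * cos e + g * sin e.
  by rewrite /f /g /dot /cross /= cosD sinD; ring.
have -> : dot (expi (v - e)) d = f * cos e - g * sin e.
  by rewrite /f /g /dot /cross /= cosB sinB; ring.
rewrite -/f => E1 E2.
have fg0 : f * g * (4 * cos e * sin e) = 0 by lra.
have fg : (g ^+ 2 - f ^+ 2) * sin e ^+ 2 = 0.
  have := cos2Dsin2 e; nra.
have fgE : f * g = 0.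
  apply/eqP; move/eqP: fg0.
  by rewrite !mulf_eq0 !(gt_eqF ce, gt_eqF se) pnatr_eq0 !orbF.
have {}fg : g ^+ 2 = f ^+ 2.
  apply/eqP; move/eqP: fg.
  by rewrite mulf_eq0 sqrf_eq0 (gt_eqF se) orbF subr_eq0.
have ff : f = 0.
  by apply/eqP; rewrite -sqrf_eq0 -sqrf_eq0 {1}expr2 -{2}fg -exprMn fgE expr0n.
apply/eqP; rewrite -dot_eq0 -[dot d d]mul1r -(dot_expi v).
have -> : dot (expi v) (expi v) * dot d d = f ^+ 2 + g ^+ 2.
  rewrite /f /g /dot /cross; move: (expi v) d {f g E1 E2 fg0 fg fgE ff}.
  by move=> [? ?] [? ?] /=; ring.
by rewrite fg ff expr0n addr0.
Qed.

Lemma continuous_line (a d : C) :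
  continuous (fun t : R => a + t%:C%C * d : R[i]^o).
Proof.
move=> t; apply: cvgD; first exact: cvg_cst.
apply: (@cvgMr_tmp _ _ _ _ (fun t : R => t%:C%C : R[i]^o)).
apply/cvgrPdist_lt => -[e e'] /=.
rewrite ltcE /= => /andP[/eqP -> e0].
near=> u.
rewrite -rmorphB normc_def /= expr0n /= addr0 sqrtr_sqr ltcR.
near: u.
exact: (@cvgr_dist_lt _ _ _ _ _ id t).
Unshelve. all: by end_near.
Qed.

Lemma continuous_along h (a d : C) : continuous (h : R[i]^o -> R) ->
  continuous (fun t : R => h (a + t%:C%C * d)).
Proof.
move=> hc t.
exact: (@continuous_comp R R[i]^o R _ h t (continuous_line a d t) (hc _)).
Qed.

(** A line through 0 will do: h differs at 0 and at some y, and the values of h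
    on the segment [0, y] fill the interval between h 0 and h y, in particular
    v - e, v, v + e where v is its midpoint. *)
Lemma nonconst_line h : continuous (h : R[i]^o -> R) ->
  ~ (exists c : R, forall w, h w = c) ->
  exists (x d : C) (r s : R), d != 0 /\
    dot (expi (h (x + r%:C%C * d))) d ^+ 2
    != dot (expi (h (x + s%:C%C * d))) d ^+ 2.
Proof.
move=> hc hN.
have [y hy] : exists y, h y != h 0.
  apply: contrapT => H; apply: hN; exists (h 0) => w.
  by apply: contrapT => /eqP W; apply: H; exists w.
pose f t := h (0 + t%:C%C * y).
have fc : continuous f.
  exact: continuous_along.
have y0 : y != 0 by apply: contra hy => /eqP ->.
pose e : R := Num.min (`|h y - h 0| / 2) 2^-1.
pose v := (h y + h 0) / 2.
have f0 : f 0 = h 0 by rewrite /f mul0r addr0.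
have f1 : f 1 = h y by rewrite /f mul1r add0r.
have e0 : 0 < e < 1.
  rewrite lt_min gt_min invf_lt1 // ltr1n orbT !andbT invr_gt0 ltr0n andbT.
  by rewrite divr_gt0 // normr_gt0 subr_eq0.
have ivt (w : R) : v - e <= w <= v + e -> exists t, f t = w.
  move=> W; have [||t _ tw] := @IVT R f 0 1 w ler01.
  - exact: continuous_subspaceT.
  - have el : e <= `|h y - h 0| / 2 by rewrite ge_min lexx.
    rewrite f0 f1 ge_min le_max; move: W; rewrite /v => /andP[w1 w2].
    case: (ler0P (h y - h 0)) el => ? el.
      by apply/andP; split; apply/orP; [right|left]; lra.
    by apply/andP; split; apply/orP; [left|right]; lra.
  - by exists t.
have /andP[e_gt0 _] := e0.
have [t0 E0] : exists t, f t = v by apply: ivt; lra.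
have [t1 E1] : exists t, f t = v + e by apply: ivt; lra.
have [t2 E2] : exists t, f t = v - e by apply: ivt; lra.
have [P1|P1] := eqVneq (dot (expi (v + e)) y ^+ 2) (dot (expi v) y ^+ 2).
  have [P2|P2] := eqVneq (dot (expi (v - e)) y ^+ 2) (dot (expi v) y ^+ 2).
    by move: (dot_expi_nonconst _ _ _ e0 P1 P2) y0 => ->; rewrite eqxx.
  by exists 0, y, t2, t0; split=> //; rewrite -/(f t2) -/(f t0) E0 E2.
by exists 0, y, t1, t0; split=> //; rewrite -/(f t1) -/(f t0) E0 E1.
Qed.

(** * Leaving the line *)

(** Continuity of a curve in the plane, read on its coordinates because dot and
    expi are given by their coordinates. *)
Definition coord_continuous (f : R -> C) :=
  continuous (fun t => complex.Re (f t))
  /\ continuous (fun t => complex.Im (f t)).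

Lemma coord_continuous_cst x : coord_continuous (fun=> x).
Proof. by split=> t; exact: cvg_cst. Qed.

Lemma coord_continuousB f g : coord_continuous f -> coord_continuous g ->
  coord_continuous (fun t => f t - g t).
Proof.
move=> [f1 f2] [g1 g2]; split.
  rewrite (_ : (fun t => _) = fun t => complex.Re (f t) - complex.Re (g t)).
    by move=> t; exact: (cvgB (f1 t) (g1 t)).
  by apply/funext => t; case: (f t) (g t) => [? ?] [? ?].
rewrite (_ : (fun t => _) = fun t => complex.Im (f t) - complex.Im (g t)).
  by move=> t; exact: (cvgB (f2 t) (g2 t)).
by apply/funext => t; case: (f t) (g t) => [? ?] [? ?].
Qed.

Lemma coord_continuous_expi (f : R -> R) : continuous f ->
  coord_continuous (fun t => expi (f t)).
Proof.
move=> fc; split=> t.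
  exact: (continuous_comp (fc t) (@continuous_cos R _)).
exact: (continuous_comp (fc t) (@continuous_sin R _)).
Qed.

Lemma coord_continuous_line (a d : C) :
  coord_continuous (fun t : R => a + t%:C%C * d).
Proof.
by case: a d => a b [c e]; split => t /=; apply: cvgD; try exact: cvg_cst;
  [apply: cvgB|apply: cvgD]; apply: cvgMr_tmp; try exact: cvg_cst;
  exact: cvg_id.
Qed.

Lemma continuous_dot f g : coord_continuous f -> coord_continuous g ->
  continuous (fun t => dot (f t) (g t)).
Proof.
move=> [f1 f2] [g1 g2] t.
by apply: cvgD; [exact: (cvgM (f1 t) (g1 t))|exact: (cvgM (f2 t) (g2 t))].
Qed.

Lemma continuous_numerator h x y w d : continuous (h : R[i]^o -> R) ->
  continuous (fun t : R => numerator h x y (w + t%:C%C * d)).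
Proof.
move=> hc.
have term (u a b c : R -> C) : coord_continuous u -> coord_continuous a ->
    coord_continuous b -> coord_continuous c -> continuous (fun t =>
      dot (u t) (a t) * dot (u t) (b t) * dot (c t) (c t)).
  move=> uc ac bc cc t; have := continuous_dot _ _ cc cc t.
  have := continuous_dot _ _ uc bc t; have := continuous_dot _ _ uc ac t.
  by move=> ua ub c2; exact: (cvgM (cvgM ua ub) c2).
have cst := coord_continuous_cst; have line := coord_continuous_line w d.
have expi_line := coord_continuous_expi _ (continuous_along h w d hc).
have sub := coord_continuousB.
have [xw wx] := (sub _ _ (cst x) line, sub _ _ line (cst x)).
have [yw wy] := (sub _ _ (cst y) line, sub _ _ line (cst y)).
have cx := term _ _ _ _ (cst (expi (h x))) (cst (x - y)) xw yw.
have cy := term _ _ _ _ (cst (expi (h y))) (cst (y - x)) yw xw.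
have cw := term _ _ _ _ expi_line wx wy (cst (x - y)).
by move=> t; exact: (cvgD (cvgD (cx t) (cy t)) (cw t)).
Qed.

Definition triple x y w : 'I_3 -> C := fun i => nth 0 [:: x; y; w] i.

(** The third point is moved by u along the normal to the line. The quantity
    e N - 2 M D^2 is continuous in u and positive at u = 0, where D = 0, so it
    stays positive for some u > 0, where D is not 0. Taking e = 1 or e = - 1
    treats the two signs of N at once. *)
Lemma remainder_unbounded_near h x d (r s t M e : R) :
  continuous (h : R[i]^o -> R) -> d != 0 -> r != s ->
  0 < e * numerator h (x + r%:C%C * d) (x + s%:C%C * d) (x + t%:C%C * d) ->
  exists z, ~ collinear z /\ M < e * (2^-1 + remainder h z).
Proof.
move=> hc d0 rs N0.
set a := x + r%:C%C * d in N0; set b := x + s%:C%C * d in N0.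
set c := x + t%:C%C * d in N0.
pose n := 'i%C * d.
pose D u := cross (b - a) (c + u%:C%C * n - a).
have DE u : D u = (s - r) * u * dot d d.
  rewrite /D /a /b /c /n; case: x d {d0 N0 a b c n D} => [? ?] [? ?].
  by rewrite /cross /dot /=; ring.
pose G u := e * numerator h a b (c + u%:C%C * n) - M * (2 * D u ^+ 2).
have Gc : continuous G.
  have Dc : continuous D.
    rewrite (_ : D = fun u => (s - r) * u * dot d d); last exact/funext.
    by move=> u; apply: cvgMr_tmp; apply: cvgMl_tmp; exact: cvg_id.
  move=> u; apply: cvgB; apply: cvgMl_tmp; first exact: continuous_numerator.
  by apply: cvgMl_tmp; apply: (cvgM (Dc u) (Dc u)).
have G0 : 0 < G 0.
  by rewrite /G DE mul0r addr0 mulr0 mul0r expr0n /= !mulr0 subr0.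
have [u [u0 Gu]] : exists u : R, 0 < u /\ 0 < G u.
  have Gr : \forall u \near 0^'+, 0 < G u.
    by apply: cvgr_gt G0; apply: cvg_at_right_filter; exact: Gc.
  have both : nbhs (0 : R)^'+ [set u | 0 < u /\ 0 < G u].
    by apply: filterI => //; exact: nbhs_right_gt.
  by have /filter_ex := both.
have Du : D u != 0.
  by rewrite DE !mulf_neq0 ?dot_eq0 ?(gt_eqF u0) // subr_eq0 eq_sym.
exists (triple a b (c + u%:C%C * n)).
have zN : ~ collinear (triple a b (c + u%:C%C * n)).
  by move/collinear_cross => /eqP; rewrite [cross _ _ == 0](negPf Du).
split=> //; rewrite half_add_remainder // mulrA ltr_pdivlMr.
  by rewrite -subr_gt0.
by rewrite mulr_gt0 // exprn_even_gt0.
Qed.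

Lemma remainder_unbounded h (M : R) : continuous (h : R[i]^o -> R) ->
  ~ (exists c : R, forall w, h w = c) ->
  (exists z, ~ collinear z /\ M < remainder h z) /\
  (exists z, ~ collinear z /\ remainder h z < - M).
Proof.
move=> hc hN; have [x [d [r [s [d0 rs]]]]] := nonconst_line h hc hN.
have rNs : r != s by apply: contra rs => /eqP ->.
pose p u := dot (expi (h (x + u%:C%C * d))) d ^+ 2.
have dd := dot_gt0 _ d0.
split.
  have [u|t W] := @divdiff_num_gt0 p (- 1) r s _ rs.
    have /andP[] := dot_expi_bounds (h (x + u%:C%C * d)) d.
    by rewrite -/(p u); lra.
  have [|z [zN]] := remainder_unbounded_near h x d r s t (M + 2^-1) 1 hc d0 rNs.
    by rewrite mul1r numerator_line mulr_gt0.
  by exists z; split => //; lra.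
have [u|t W] := @divdiff_num_lt0 p (dot d d + 1) r s _ rs.
  have /andP[] := dot_expi_bounds (h (x + u%:C%C * d)) d.
  by rewrite -/(p u); lra.
have [|z [zN]] := remainder_unbounded_near h x d r s t M (- 1) hc d0 rNs.
  by rewrite mulN1r numerator_line -mulrN mulr_gt0 // oppr_gt0.
by exists z; split => //; lra.
Qed.

End Planar.

Theorem theorem2p5 (R : realType) (h : R[i] -> R) (h_cont : continuous (h : R[i]^o -> R)) :
  ((exists c : R, forall w, h w = c) ->
    forall z : 'I_3 -> R[i], ~ collinear z -> 0 < 2^-1 + remainder h z)
  /\
  (~ (exists c : R, forall w, h w = c) ->
    exists z z' : 'I_3 -> R[i],
      [/\ ~ collinear z, ~ collinear z',
          0 < 2^-1 + remainder h z & 2^-1 + remainder h z' < 0])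
  /\
  ((exists c : R, forall w, h w = c) ->
    forall z : 'I_3 -> R[i], ~ collinear z -> 0 < 2^-1 - remainder h z)
  /\
  (~ (exists c : R, forall w, h w = c) ->
    exists z z' : 'I_3 -> R[i],
      [/\ ~ collinear z, ~ collinear z',
          0 < 2^-1 - remainder h z & 2^-1 - remainder h z' < 0]).
Proof.
split; [|split; [|split]].
- by move=> [c hc] z zN; rewrite (remainder_const _ _ _ hc zN); lra.
- move=> /(remainder_unbounded _ 2^-1 h_cont) [[z [zN zM]] [z' [zN' zM']]].
  by exists z, z'; split => //; lra.
- by move=> [c hc] z zN; rewrite (remainder_const _ _ _ hc zN); lra.
- move=> /(remainder_unbounded _ 2^-1 h_cont) [[z [zN zM]] [z' [zN' zM']]].
  by exists z', z; split => //; lra.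
Qed.
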